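(* Let $a,d,k$ be positive integers with $\gcd(a,d)=1$ and $2\le k\le a$. Put $b=a+(k-1)d$ and $\lambda=\left\lfloor\frac{a-2}{k-1}\right\rfloor$, and let $d_a,q_a$ be the integers with $dd_a=1+q_a a$, $1\le d_a<a$, $0\le q_a<d$. Let $S=\langle a,a+d,a+2d,\ldots,a+(k-1)d\rangle$, and let $\alpha,\beta\in[1,\infty)\cap\mathbb{Q}$. Consider the following conditions on $(\alpha,\beta)$. (A) $\displaystyle \frac{\lambda a+d(a-1)}{\lambda d_a+q_a(a-1)+1}<\alpha\le\frac{a}{d_a}$ and $\displaystyle \frac{b}{d_a+(a-1)q_a}\le\beta<\frac{\lambda b+d}{\lambda\big(d_a+(a-1)q_a\big)+q_a}$. (B) $\displaystyle \frac{\lambda b+d}{\lambda\big(b-d_a-(a-1)q_a\big)+(d-q_a)}<\alpha\le\frac{b}{b-d_a-(a-1)q_a}$ and $\displaystyle \frac{a}{a-d_a}\le\beta<\frac{\lambda a+d(a-1)}{\lambda(a-d_a)+(d-q_a)(a-1)-1}$. (C) $\displaystyle \frac{d(a-1)}{q_a(a-1)+1}<\alpha\le\frac{b}{(a-1)q_a+d_a+1}$ and $\displaystyle \frac{b-d}{(a-2)q_a+d_a}\le\beta<\frac{d}{q_a}$. (D) $\displaystyle \frac{d}{d-q_a}<\alpha\le\frac{b-d}{b-d-(a-2)q_a-d_a}$ and $\displaystyle \frac{b}{b-(a-1)q_a-d_a-1}\le\beta<\frac{d(a-1)}{(d-q_a)(a-1)-1}$. If $k<a$, then $S([\alpha,\beta])=S$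 if and only if (A) or (B) holds. If $k=a$, then $S([\alpha,\beta])=S$ if and only if (A) or (B) or (C) or (D) holds.
   Context: For a set $A$ of positive integers, $\langle A\rangle$ denotes the submonoid of $\mathbb{Z}_{\ge0}$ (under addition, containing $0$) generated by $A$. For an interval $I=[\alpha,\beta]$, $\langle I\rangle$ denotes the submonoid of $\mathbb{Q}_{\ge0}$ generated by the rational numbers in $I$, i.e. the set of all finite sums of elements of $I\cap\mathbb{Q}$ together with $0$, and $S(I)=\langle I\rangle\cap\mathbb{Z}_{\ge0}$. The convention $\frac{1}{0}=\infty$ is adopted.
   Formalization: In the β-bounds of (A) and the α-bounds of (B), d_a+(a-1)q_a is corrected to d_a+(k-1)q_a (the same if k=a or q_a=0); as printed the claim fails for a=3, d=2, k=2: α=3/2, β=5/4 satisfies (A) though [α,β] is empty. *)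

(* Defs.v *)
From mathcomp Require Import all_boot all_order all_algebra.
From mathcomp Require Import classical_sets set_interval constructive_ereal.
Set Implicit Arguments.
Unset Strict Implicit.
Unset Printing Implicit Defensive.
Import Order.TTheory GRing.Theory Num.Theory.
Local Open Scope classical_set_scope.
Local Open Scope ring_scope.

(* <A>: all finite sums of elements of A; the empty sum gives 0. *)
Definition submonoid_gen (V : nmodType) (A : set V) : set V :=
  [set x | exists s : seq V, (forall y, y \in s -> A y) /\ x = \sum_(y <- s) y].

(* S(I) = <I> `&` Z_{>=0}, as a set of natural numbers. *)
Definition S_of_interval (I : interval rat) : set nat :=
  [set n | submonoid_gen [set` I] (n%:R : rat)].

(* n / m with the convention n / 0 = +oo, which is only used for n > 0. *)
Definition frac (n m : int) : \bar rat :=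
  if m == 0 then +oo%E else (n%:~R / m%:~R)%:E.
Arguments frac (n m)%_R.

(* The conditions are computed in int, so subtraction is never truncated.
   In condA and condB the generator b = a + (k - 1) d is paired with
   e = d_a + (k - 1) q_a: consecutive fractions (a + i d) / (d_a + i q_a) have
   determinant d d_a - a q_a = 1.  Replacing e by d_a + (a - 1) q_a, which is
   the same for k = a, gives false conditions for k < a: if (a, d, k) = (3, 2, 2)
   then d_a = 2, q_a = 1, lam = 1 and S([3/2, 5/3]) = <3, 5>, but the variant of
   condA forces beta < 7/5 and the variant of condB forces 7/2 < alpha. *)
Definition condA (a d k lam d_a q_a : int) (alpha beta : rat) : Prop :=
  let b := a + (k - 1) * d in
  let e := d_a + (k - 1) * q_a in
  (frac (lam * a + d * (a - 1)) (lam * d_a + q_a * (a - 1) + 1)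
     < alpha%:E <= frac a d_a)%E /\
  (frac b e <= beta%:E < frac (lam * b + d) (lam * e + q_a))%E.

Definition condB (a d k lam d_a q_a : int) (alpha beta : rat) : Prop :=
  let b := a + (k - 1) * d in
  let e := d_a + (k - 1) * q_a in
  (frac (lam * b + d) (lam * (b - e) + (d - q_a))
     < alpha%:E <= frac b (b - e))%E /\
  (frac a (a - d_a) <= beta%:E
     < frac (lam * a + d * (a - 1))
            (lam * (a - d_a) + (d - q_a) * (a - 1) - 1))%E.

Definition condC (a d k d_a q_a : int) (alpha beta : rat) : Prop :=
  let b := a + (k - 1) * d in
  (frac (d * (a - 1)) (q_a * (a - 1) + 1)
     < alpha%:E <= frac b ((a - 1) * q_a + d_a + 1))%E /\
  (frac (b - d) ((a - 2) * q_a + d_a) <= beta%:E < frac d q_a)%E.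

Definition condD (a d k d_a q_a : int) (alpha beta : rat) : Prop :=
  let b := a + (k - 1) * d in
  (frac d (d - q_a)
     < alpha%:E <= frac (b - d) (b - d - (a - 2) * q_a - d_a))%E /\
  (frac b (b - (a - 1) * q_a - d_a - 1) <= beta%:E
     < frac (d * (a - 1)) ((d - q_a) * (a - 1) - 1))%E.

(* Main.v *)
Require Import Defs.
From mathcomp Require Import all_boot all_order all_algebra.
From mathcomp Require Import classical_sets set_interval constructive_ereal.
From mathcomp Require Import zify ring lra.
Set Implicit Arguments.
Unset Strict Implicit.
Unset Printing Implicit Defensive.
Import Order.TTheory GRing.Theory Num.Theory.
Local Open Scope classical_set_scope.
Local Open Scope ring_scope.

(* With u = 1/beta and v = 1/alpha, n lies in S([alpha, beta]) iff some lattice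
   point (n, m) lies in the cone n u <= m <= n v.  The reflection m -> n - m
   replaces (u, v) by (1 - v, 1 - u) and exchanges (A) with (B), (C) with (D).
   Suppose that the cone projects onto S.  Since d is not in S, some integer q
   has q < d u <= d v < q + 1.  The point P_0 = (a, m) of the cone over a is
   unique, and up to reflection P_0 + (d, q) is in the cone.  If
   D = d m - a q were > 1, the parallelogram on these two points would contain
   another lattice point, giving an impossible decomposition of 2a + d in S;
   so D = 1, which forces m = d_a and q = q_a.  Following
   P_i = P_0 + i (d, q) for i < k, either all of them are in the cone, and the
   two non-members lam a + d (a - 1) and lam b + d of S give the strict bounds
   of (A); or some P_i leaves the cone, P_i + (0, 1) is in it, and then
   (a - 1) d not in S forces i = k - 1 = a - 1, which is (C).
   Conversely, in the basis (a, d_a), (d, q_a) of Z^2 the bounds confine the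
   lattice points of the cone to those over S. *)

(** * The cone, the semigroup and the conditions in terms of slopes *)

Definition in_cone (u v : rat) (n m : int) : bool :=
  n%:~R * u <= m%:~R <= n%:~R * v.

(** In a sum of generators [a + i * d], [x] counts the summands and [y] adds up their indices; [c]
    stands for [k - 1]. For [c > 0] the bounds on [y] force [x] to be nonnegative. *)
Definition arith_sg (a d c n : int) : Prop :=
  exists x y : int, n = x * a + y * d /\ 0 <= y <= x * c.

Definition cone_spans (u v : rat) (a d c : int) : Prop :=
  forall n : int, 0 <= n ->
    (exists m, in_cone u v n m) <-> arith_sg a d c n.

(** [lam_le] and [lam_gt] characterise [l] as the floor of [(a - 2) / c]; [det1] contains the
    coprimality of [a] and [d]. *)
Record sg_params (a d c l da q : int) : Prop := SgParams {
  a_ge2 : 2 <= a; d_gt0 : 0 < d; c_gt0 : 1 <= c; c_lt : c <= a - 1;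
  lam_le : l * c <= a - 2; lam_gt : a - 1 <= (l + 1) * c;
  det1 : d * da = 1 + q * a;
  da_ge1 : 1 <= da; da_lt : da < a; q_ge0 : 0 <= q; q_lt : q < d }.

(** Condition (A) with denominators cleared, for [u] = 1/beta and [v] = 1/alpha. In this linear form
    the same predicate at [1 - v] and [1 - u] expresses (B). *)
Definition slopesA (u v : rat) (a d c l da q : int) : Prop :=
  let b := a + c * d in
  let e := da + c * q in
  [/\ (l * a + d * (a - 1))%:~R * v < (l * da + q * (a - 1) + 1)%:~R,
      da%:~R <= a%:~R * v,
      b%:~R * u <= e%:~R
    & (l * e + q)%:~R < (l * b + d)%:~R * u].

Definition slopesC (u v : rat) (a d da q : int) : Prop :=
  let b := a + (a - 1) * d in
  [/\ (d * (a - 1))%:~R * v < (q * (a - 1) + 1)%:~R,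
      ((a - 1) * q + da + 1)%:~R <= b%:~R * v,
      (b - d)%:~R * u <= ((a - 2) * q + da)%:~R
    & q%:~R < d%:~R * u].

(** * Comparison of slopes, and operations on the lattice points of a cone *)

Lemma slope_le (r : rat) (n m N M : int) :
  N%:~R * r <= M%:~R -> 0 < N -> 0 <= n -> n * M <= m * N ->
  n%:~R * r <= m%:~R.
Proof.
move=> rM N0 n0; rewrite -(ler_int rat) !intrM => h.
have N0' : 0 < N%:~R :> rat by rewrite ltr0z.
have n0' : 0 <= n%:~R :> rat by rewrite ler0z.
rewrite -(ler_pM2l N0'); nra.
Qed.

Lemma slope_ge (r : rat) (n m N M : int) :
  M%:~R <= N%:~R * r -> 0 < N -> 0 <= n -> m * N <= n * M ->
  m%:~R <= n%:~R * r.
Proof.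
move=> rM N0 n0; rewrite -(ler_int rat) !intrM => h.
have N0' : 0 < N%:~R :> rat by rewrite ltr0z.
have n0' : 0 <= n%:~R :> rat by rewrite ler0z.
rewrite -(ler_pM2l N0'); nra.
Qed.

Lemma slope_lt (r : rat) (n m N M : int) :
  m%:~R <= n%:~R * r -> N%:~R * r < M%:~R -> 0 < n -> 0 <= N ->
  m * N < n * M.
Proof.
move=> h1 h2 n0 N0; rewrite -(ltr_int rat) !intrM.
have n0' : 0 < n%:~R :> rat by rewrite ltr0z.
have N0' : 0 <= N%:~R :> rat by rewrite ler0z.
nra.
Qed.

Lemma slope_gt (r : rat) (n m N M : int) :
  n%:~R * r <= m%:~R -> M%:~R < N%:~R * r -> 0 < n -> 0 <= N ->
  n * M < m * N.
Proof.
move=> h1 h2 n0 N0; rewrite -(ltr_int rat) !intrM.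
have n0' : 0 < n%:~R :> rat by rewrite ltr0z.
have N0' : 0 <= N%:~R :> rat by rewrite ler0z.
nra.
Qed.

Lemma in_coneD u v n m n' m' :
  in_cone u v n m -> in_cone u v n' m' -> in_cone u v (n + n') (m + m').
Proof. by rewrite /in_cone => /andP[? ?] /andP[? ?]; apply/andP; split; lra. Qed.

Lemma in_coneMl u v k n m : 0 <= k -> in_cone u v n m -> in_cone u v (k * n) (k * m).
Proof.
move=> k0 /andP[? ?]; have k0' : 0 <= k%:~R :> rat by rewrite ler0z.
by rewrite /in_cone !intrM; apply/andP; split; nra.
Qed.

Lemma in_cone_div u v k n m : 0 < k -> in_cone u v (k * n) (k * m) -> in_cone u v n m.
Proof.
move=> k0; have k0' : 0 < k%:~R :> rat by rewrite ltr0z.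
by rewrite /in_cone !intrM -!mulrA !ler_pM2l.
Qed.

Lemma in_cone_reflect u v n m : in_cone (1 - v) (1 - u) n (n - m) = in_cone u v n m.
Proof. by rewrite /in_cone; apply/idP/idP => /andP[? ?]; apply/andP; split; lra. Qed.

Lemma cone_spans_reflect u v a d c :
  cone_spans u v a d c -> cone_spans (1 - v) (1 - u) a d c.
Proof.
move=> uvP n n0; rewrite -(uvP n n0); split=> -[m mP].
  by exists (n - m); rewrite -in_cone_reflect; congr (in_cone _ _ _ _): mP; lia.
by exists (n - m); rewrite in_cone_reflect.
Qed.

(** By coprimality every other representation is [(x + w * d, y - w * a)]. A nonnegative second
    entry and [y < a] force [w <= 0], so the first entry can only shrink and the second only grow:
    the reduced pair meets the bound whenever some pair does. *)
Lemma arith_sg_coordP a d c l da q n x y : sg_params a d c l da q ->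
  n = x * a + y * d -> 0 <= y < a -> (arith_sg a d c n <-> y <= x * c).
Proof.
move=> H nE /andP[y0 ya]; split; last by move=> yx; exists x, y; split; lia.
case: H => a2 d0 c1 _ _ _ det _ _ _ _ [t [s [nE' /andP[s0 st]]]].
set w := (t - x) * da - (y - s) * q.
have e : (t - x) * a = (y - s) * d by lia.
have yw : y - s = a * w.
  have -> : a * w = (t - x) * a * da - (y - s) * q * a by rewrite /w; ring.
  have -> : (t - x) * a * da = (y - s) * (d * da) by rewrite e; ring.
  by rewrite det; ring.
have tw : t = x + w * d.
  apply/eqP; rewrite -subr_eq0; apply/eqP; apply: (@mulIf _ a); first lia.
  have -> : (t - (x + w * d)) * a = (t - x) * a - (a * w) * d by ring.
  by rewrite e -yw; ring.
have w0 : w <= 0 by nia.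
rewrite tw in st; nia.
Qed.

(** * Sufficiency of (A) and (C), by coordinates in a unimodular basis *)

Lemma basis_coords (a d da q n m : int) : d * da = 1 + q * a ->
  exists x y, n = x * a + y * d /\ m = x * da + y * q.
Proof.
move=> det; exists (m * d - n * q), (n * da - m * a); split.
- transitivity (n * (d * da - q * a)); last by ring.
  by rewrite det; ring.
- transitivity (m * (d * da - q * a)); last by ring.
  by rewrite det; ring.
Qed.

(** After [y] is reduced modulo [a], either [0 <= y <= x * c] held already and persists, or the new
    first entry is at least [l + 1], which is enough because [(l + 1) * c >= a - 1]. The strict
    bound on [u] yields this when [y > x * c], the one on [v] when [y < 0]. *)
Lemma slopesA_spans u v a d c l da q : sg_params a d c l da q ->
  slopesA u v a d c l da q -> cone_spans u v a d c.
Proof.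
move=> H [v_lt v_ge u_le u_gt] n n0.
have [a2 d0 c1 ca lle lgt det da1 daa q0 qd] := H.
have l0 : 0 <= l by nia.
split.
- case=> m /andP[mu mv].
  have [->|nn0] := eqVneq n 0; first by exists 0, 0; split; lia.
  have {}n0 : 0 < n by lia.
  have up := slope_lt mv v_lt n0 ltac:(nia).
  have lo := slope_gt mu u_gt n0 ltac:(nia).
  have [x [y [nE mE]]] := basis_coords n m det.
  rewrite {}nE {}mE {mu mv nn0 n0} in lo up *.
  (* The cross products with the two strict bounds are read in coordinates; inserting the factor
     [d * da - q * a], which is 1, makes each comparison a polynomial identity. *)
  have {}lo : l * y < (l * c + 1) * x.
    rewrite -subr_gt0.
    have -> : (l * c + 1) * x - l * y = ((l * c + 1) * x - l * y) * (d * da - q * a).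
      by rewrite det; ring.
    by move: lo; rewrite -subr_gt0; apply: etrans; congr (0 < _); ring.
  have {}up : 0 < x + y * (d + l).
    move: up; rewrite -subr_gt0; apply: etrans; congr (0 < _).
    have -> : x + y * (d + l) = x * a + y * d + (y * l - x * (a - 1)) * (d * da - q * a).
      by rewrite det; ring.
    by ring.
  (* Taking [w * a] out of [y] adds [w * d] to [x], which produces the reduced pair. *)
  set w := (y %/ a)%Z; set z := (y %% a)%Z.
  have yE : y = w * a + z by exact: divz_eq.
  have z0 : 0 <= z by apply: modz_ge0; lia.
  have za : z < a by apply: ltz_pmod; lia.
  clearbody w z.
  apply/(arith_sg_coordP (x := x + w * d) (y := z) H); [by rewrite yE; ring|lia|].
  case: (lerP 0 y) => y0; last first.
    have xw : l + 1 <= x + w * d.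
      have w1 : y <= w by nia.
      have : y * d <= w * d by rewrite ler_pM2r.
      nia.
    have := ler_wpM2r (ltac:(lia) : 0 <= c) xw; lia.
  have w0 : 0 <= w by nia.
  have wd0 : 0 <= w * d by rewrite mulr_ge0 // ltW.
  case: (lerP y (x * c)) => yx.
    have : 0 <= w * d * c by rewrite mulr_ge0 //; lia.
    have : 0 <= w * a by rewrite mulr_ge0 //; lia.
    lia.
  have xl : l + 1 <= x.
    have : l * (y - x * c) < x by lia.
    have : l * 1 <= l * (y - x * c) by apply: ler_wpM2l => //; lia.
    lia.
  have := ler_wpM2r (ltac:(lia) : 0 <= c) (ltac:(lia) : l + 1 <= x + w * d); lia.
- case=> x [y [-> /andP[y0 yx]]].
  exists (x * da + y * q); apply/andP; split.
  + apply: (slope_le u_le); nia.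
  + apply: (slope_ge v_ge); nia.
Qed.

Lemma arith_sg_cone u v a d c n : 0 < c ->
  (forall i, 0 <= i <= c -> exists m, in_cone u v (a + i * d) m) ->
  arith_sg a d c n -> exists m, in_cone u v n m.
Proof.
move=> c0 gen [x [y [-> /andP[y0 yx]]]].
have [x0|x0] := ltrP x 0; first by nia.
case: x x0 yx => // x _; elim: x y y0 => [|x IHx] y y0 yx.
  by exists 0; rewrite /in_cone (_ : y = 0) ?mul0r ?lexx //; lia.
(* One generator absorbs all of [y] if its index can be that large, and otherwise takes the largest
   index [c]. *)
have [yc|yc] := lerP y c.
  have [m mP] := gen y ltac:(lia); have [m' mP'] := IHx 0 ltac:(lia) ltac:(nia).
  by exists (m + m'); have := in_coneD mP mP'; congr (in_cone _ _ _ _); lia.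
have [m mP] := gen c ltac:(lia).
have [m' mP'] := IHx (y - c) ltac:(lia) ltac:(lia).
by exists (m + m'); have := in_coneD mP mP'; congr (in_cone _ _ _ _); lia.
Qed.

(** As [c = a - 1], a reduced pair lies over the semigroup as soon as its first entry is positive,
    and the two strict bounds ensure just that. Conversely it suffices to lift the generators. *)
Lemma slopesC_spans u v a d l da q : sg_params a d (a - 1) l da q ->
  slopesC u v a d da q -> cone_spans u v a d (a - 1).
Proof.
move=> H [v_lt v_ge u_le u_gt] n n0.
have [a2 d0 _ _ _ _ det da1 daa q0 qd] := H.
have a1q : 0 <= (a - 1) * q by rewrite mulr_ge0 //; lia.
have a2q : 0 <= (a - 2) * q by rewrite mulr_ge0 //; lia.
have a2d : 0 <= (a - 2) * d by rewrite mulr_ge0 //; lia.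
have Pgen i : 0 <= i <= a - 1 -> exists m, in_cone u v (a + i * d) m.
  move=> /andP[i0 ia]; have id0 : 0 <= i * d by rewrite mulr_ge0 // ltW.
  have [->|ni] := eqVneq i (a - 1).
    (* Only the last generator is lifted one unit above the line through the other lifts. *)
    exists ((a - 1) * q + da + 1); apply/andP; split=> //.
    apply: (slope_le u_le); [nia|nia|rewrite -subr_ge0].
    set X := (X in 0 <= X).
    have -> : X = a + (a - 2) * d - (d * da - q * a) by rewrite /X; ring.
    by rewrite det; lia.
  exists (da + i * q); apply/andP; split.
    apply: (slope_le u_le); [nia|nia|rewrite -subr_ge0].
    set X := (X in 0 <= X).
    have -> : X = (a - 2 - i) * (d * da - q * a) by rewrite /X; ring.
    by rewrite det; lia.
  apply: (slope_ge v_ge); [nia|nia|rewrite -subr_ge0].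
  set X := (X in 0 <= X).
  have -> : X = a + i * d - (a - 1 - i) * (d * da - q * a) by rewrite /X; ring.
  by rewrite det; lia.
split.
- case=> m /andP[mu mv].
  have [->|nn0] := eqVneq n 0; first by exists 0, 0; split; lia.
  have {}n0 : 0 < n by lia.
  have up := slope_lt mv v_lt n0 ltac:(nia).
  have lo := slope_gt mu u_gt n0 ltac:(nia).
  have [x [y [nE mE]]] := basis_coords n m det.
  rewrite {}nE {}mE {mu mv nn0 n0} in lo up *.
  have {}lo : 0 < x.
    have -> : x = x * (d * da - q * a) by rewrite det; ring.
    by move: lo; rewrite -subr_gt0; apply: etrans; congr (0 < _); ring.
  have {}up : 0 < x + y * d.
    move: up; rewrite -subr_gt0; apply: etrans; congr (0 < _).
    have -> : x + y * d = x * a + y * d - x * (a - 1) * (d * da - q * a).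
      by rewrite det; ring.
    by ring.
  set w := (y %/ a)%Z; set z := (y %% a)%Z.
  have yE : y = w * a + z by exact: divz_eq.
  have z0 : 0 <= z by apply: modz_ge0; lia.
  have za : z < a by apply: ltz_pmod; lia.
  clearbody w z.
  apply/(arith_sg_coordP (x := x + w * d) (y := z) H); [by rewrite yE; ring|lia|].
  have xw : 1 <= x + w * d.
    case: (lerP 0 y) => y0.
      have w0 : 0 <= w by nia.
      have : 0 <= w * d by rewrite mulr_ge0 // ltW.
      lia.
    have yw : y <= w by nia.
    have : y * d <= w * d by rewrite ler_pM2r.
    lia.
  have := ler_wpM2r (ltac:(lia) : 0 <= a - 1) xw; lia.
- by apply: arith_sg_cone => //; lia.
Qed.

(** * Necessity: non-members of the semigroup restrict the cone *)

Lemma arith_sg_multd a d c l da q s : sg_params a d c l da q ->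
  1 <= s < a -> ~ arith_sg a d c (s * d).
Proof.
move=> H ? /(arith_sg_coordP H (x := 0) (y := s)) h.
by have := h ltac:(lia) ltac:(lia); lia.
Qed.

Lemma arith_sg_lt a d c n : arith_sg a d c n -> 0 < a -> 0 < d -> 0 < c ->
  n < a + d -> exists2 t, 0 <= t & n = t * a.
Proof.
move=> [x [y [-> /andP[y0 yx]]]] a0 d0 c0 lt.
have x0 : 0 <= x by nia.
exists x => //; have [->|yn] := eqVneq y 0; first by lia.
have : 1 <= x by nia.
nia.
Qed.

Lemma arith_sg_ge a d c n : arith_sg a d c n -> 0 < a -> 0 < d -> 0 < c ->
  0 < n -> a <= n.
Proof.
move=> [x [y [-> /andP[y0 yx]]]] a0 d0 c0 lt.
have x0 : 0 < x by nia.
nia.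
Qed.

Lemma arith_sg_gen a d c i : 0 <= i <= c -> arith_sg a d c (a + i * d).
Proof. by exists 1, i; split; lia. Qed.

Lemma in_cone_convex u v n m m' m'' : in_cone u v n m -> in_cone u v n m'' ->
  m <= m' <= m'' -> in_cone u v n m'.
Proof.
move=> /andP[h _] /andP[_ h'] /andP[]; rewrite -(ler_int rat) -(ler_int rat m').
by move=> ? ?; apply/andP; split; lra.
Qed.

Lemma not_in_cone_above u v n m N M : in_cone u v N M -> ~~ in_cone u v n m ->
  0 < N -> 0 <= n -> n * M <= m * N -> n%:~R * v < m%:~R.
Proof.
move=> /andP[h _] nk N0 n0 le; have h' := slope_le h N0 n0 le.
by move: nk; rewrite /in_cone h' /= -ltNge.
Qed.

Lemma not_in_cone_below u v n m N M : in_cone u v N M -> ~~ in_cone u v n m ->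
  0 < N -> 0 <= n -> m * N <= n * M -> m%:~R < n%:~R * u.
Proof.
move=> /andP[_ h] nk N0 n0 le; have h' := slope_ge h N0 n0 le.
by move: nk; rewrite /in_cone h' andbT -ltNge.
Qed.

Lemma cone_spans_mem u v a d c n m : cone_spans u v a d c ->
  0 <= n -> in_cone u v n m -> arith_sg a d c n.
Proof. by move=> uvP n0 mP; apply/(uvP n n0); exists m. Qed.

(** Two points over [a] would give consecutive ones [m] and [m + 1]. Since [u >= 0] and [v <= 1],
    [(a - 1, m)] would then be in the cone, although no positive element of the semigroup is below
    [a]. *)
Lemma cone_unique u v a d c m m' : 0 <= u -> v <= 1 ->
  1 < a -> 0 < d -> 0 < c -> cone_spans u v a d c ->
  in_cone u v a m -> in_cone u v a m' -> m = m'.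
Proof.
move=> u0 v1 a1 d0 c0 uvP; wlog lt : m m' / m < m' => [hw|].
  by case: (ltgtP m m') => // ? ? ?; [|symmetry]; apply: hw.
move=> mP m'P; have := in_cone_convex (m' := m + 1) mP m'P ltac:(lia).
move=> /andP[_ mP1]; case/andP: mP => mP _.
have h : arith_sg a d c (a - 1).
  apply: (cone_spans_mem (m := m) uvP); first lia.
  by apply/andP; split; lra.
by have := arith_sg_ge h ltac:(lia) d0 c0 ltac:(lia); lia.
Qed.

(** For P = [(n, m)] and Q = [(n', m')], the vector [- n'] P + [n] Q is (0, [D]), so dividing it by
    [D] gives a lattice point. Reducing both coefficients modulo [D] changes this point by a lattice
    vector and moves it into the parallelogram. *)
Lemma parallelogram_point u v n m n' m' D :
  D = n * m' - n' * m -> 1 < `|D| ->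
  in_cone u v n m -> in_cone u v n' m' -> 0 < n -> 0 < n' ->
  coprimez n n' ->
  exists x y, [/\ in_cone u v x y, in_cone u v (n + n' - x) (m + m' - y),
    0 < x < n + n', (x, y) <> (n, m) & (x, y) <> (n', m')].
Proof.
move=> DE D1 P Q n0 n'0 cop.
wlog Dgt1 : n m n' m' D DE D1 P Q n0 n'0 cop / 1 < D => [hw|].
  move: (D1); rewrite ltr_normr => /orP[D2|D2].
    exact: hw DE D1 P Q n0 n'0 cop D2.
  have [|||x [y [T T' x0 n1 n2]]] := hw n' m' n m (- D) _ _ Q P n'0 n0 _ D2.
  - by rewrite DE; ring.
  - by rewrite normrN.
  - by rewrite coprimez_sym.
  by exists x, y; rewrite (addrC n) (addrC m).
have D0 : 0 < D by lia.
set r := (- n' %% D)%Z; set s := (n %% D)%Z.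
set r' := (- n' %/ D)%Z; set s' := (n %/ D)%Z.
have rE : - n' = r' * D + r by exact: divz_eq.
have sE : n = s' * D + s by exact: divz_eq.
have r0 : 0 <= r by apply: modz_ge0; lia.
have rD : r < D by apply: ltz_pmod.
have s0 : 0 <= s by apply: modz_ge0; lia.
have sD : s < D by apply: ltz_pmod.
clearbody r s r' s'.
have {}rE : r = - n' - r' * D by rewrite rE; ring.
have {}sE : s = n - s' * D by rewrite [X in X - _]sE; ring.
set x := - (r' * n + s' * n'); set y := 1 - (r' * m + s' * m').
have xE : D * x = r * n + s * n' by rewrite rE sE /x; ring.
have yE : D * y = r * m + s * m'.
  transitivity (D * (y - 1) + (n * m' - n' * m)); first by rewrite -DE; ring.
  by rewrite rE sE /y; ring.
clearbody x y.
(* If both remainders vanished, [D] would divide the coprime [n] and [n']. *)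
have rs0 : (0 < r) || (0 < s).
  rewrite !lt_neqAle r0 s0 !andbT -negb_and; apply/negP => /andP[/eqP r00 /eqP s00].
  have : (D %| gcdz n n')%Z.
    rewrite dvdz_gcd; apply/andP; split; apply/dvdzP.
      by exists s'; move: sE; rewrite -s00; lia.
    by exists (- r'); move: rE; rewrite -r00; lia.
  by rewrite (eqP cop) dvdz1 => /eqP; lia.
have x0 : 0 < D * x.
  have rn := mulr_ge0 r0 (ltW n0); have sn := mulr_ge0 s0 (ltW n'0).
  rewrite xE; case/orP: rs0 => [/mulr_gt0/(_ n0)|/mulr_gt0/(_ n'0)] ?; lia.
have x1 : D * x < D * (n + n').
  have rn : r * n < D * n by rewrite ltr_pM2r.
  have sn : s * n' < D * n' by rewrite ltr_pM2r.
  by rewrite xE mulrDr; lia.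
exists x, y; split.
- apply: (in_cone_div D0); rewrite xE yE.
  by apply: in_coneD; apply: in_coneMl.
- apply: (in_cone_div D0); rewrite !mulrBr xE yE.
  have := in_coneD (in_coneMl (ltac:(lia) : 0 <= D - r) P)
                   (in_coneMl (ltac:(lia) : 0 <= D - s) Q).
  by congr in_cone; ring.
- by rewrite pmulr_rgt0 // ltr_pM2l // in x0 x1; apply/andP.
- case=> xn ym; rewrite xn in xE; rewrite ym in yE.
  have : (D - r) * D = 0.
    transitivity ((D * n - r * n) * m' - (D * m - r * m) * n').
      by rewrite {2}DE; ring.
    by rewrite xE yE; ring.
  by move/eqP; rewrite mulf_eq0 => /orP[] /eqP; lia.
- case=> xn ym; rewrite xn in xE; rewrite ym in yE.
  have : (D - s) * D = 0.
    transitivity (n * (D * m' - s * m') - m * (D * n' - s * n')).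
      by rewrite {2}DE; ring.
    by rewrite xE yE; ring.
  by move/eqP; rewrite mulf_eq0 => /orP[] /eqP; lia.
Qed.

(** A larger determinant would split [2 * a + d] into two positive elements of the semigroup, hence
    both at least [a] and at most [a + d]. Uniqueness over [a] excludes the extreme values. *)
Lemma spans_det u v a d c l da q0 m q : sg_params a d c l da q0 ->
  0 <= u -> v <= 1 -> cone_spans u v a d c ->
  in_cone u v a m -> in_cone u v (a + d) (m + q) ->
  q%:~R < d%:~R * u -> d * m - a * q = 1.
Proof.
move=> H u0 v1 uvP P0 P1 qu.
have [a2 d0 c1 ca lle lgt det da1 daa q00 q0d] := H.
have D0 : 0 < d * m - a * q.
  by case/andP: P0 => P0 _; have := slope_gt P0 qu ltac:(lia) ltac:(lia); lia.
apply/eqP; rewrite eq_le -[X in _ && X]gtz0_ge1 D0 andbT leNgt; apply/negP => D1.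
have cop : coprimez a (a + d).
  apply/coprimezP; exists (- q0 - da, da) => /=.
  by transitivity (d * da - q0 * a); [ring|rewrite det; ring].
have DE : - (d * m - a * q) = a * (m + q) - (a + d) * m by ring.
have [x [y [T T' /andP[x0 x0'] n0 n1]]] :=
  parallelogram_point DE ltac:(by rewrite normrN gtr0_norm) P0 P1
    ltac:(lia) ltac:(lia) cop.
have S : arith_sg a d c x by apply: (cone_spans_mem uvP _ T); lia.
have S' : arith_sg a d c (a + (a + d) - x).
  by apply: (cone_spans_mem uvP _ T'); lia.
have xa := arith_sg_ge S ltac:(lia) d0 c1 ltac:(lia).
have x'a := arith_sg_ge S' ltac:(lia) d0 c1 ltac:(lia).
have [xE|xN] := eqVneq x a.
  rewrite xE in T n0; have := cone_unique u0 v1 a2 d0 c1 uvP P0 T.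
  by move=> E; apply: n0; rewrite E.
have [xE|xN'] := eqVneq x (a + d).
  rewrite (_ : _ - x = a) in T'; last by lia.
  have E := cone_unique u0 v1 a2 d0 c1 uvP P0 T'.
  by apply: n1; congr pair; lia.
(* Both parts are now below [a + d], hence multiples of [a]; then [a] divides [d], against
   coprimality. *)
have [t _ tE] := arith_sg_lt S ltac:(lia) d0 c1 ltac:(lia).
have [t' _ tE'] := arith_sg_lt S' ltac:(lia) d0 c1 ltac:(lia).
have dE : d = (t + t' - 2) * a by lia.
have : (a %| 1)%Z.
  apply/dvdzP; exists ((t + t' - 2) * da - q0).
  by transitivity (d * da - q0 * a); [rewrite det; ring|rewrite dE; ring].
by rewrite dvdz1 => /eqP; lia.
Qed.

Lemma det_unique (a d m q m' q' : int) : 0 < d -> d * m - a * q = 1 ->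
  d * m' - a * q' = 1 -> 0 <= m < a -> 0 <= m' < a -> m = m' /\ q = q'.
Proof.
move=> d0 e e' b b'.
have E : m - m' = a * (m' * (q - q') - q' * (m - m')).
  transitivity ((m - m') * (d * m' - a * q') -
                m' * ((d * m - a * q) - (d * m' - a * q'))).
    by rewrite e e'; ring.
  by ring.
have mE : m = m'.
  move: (_ - q' * _) E => Z E; have [Z0|Z0|Z0] := ltgtP Z 0.
  - have : a * Z <= a * -1 by apply: ler_wpM2l; lia.
    lia.
  - have : a * 1 <= a * Z by apply: ler_wpM2l; lia.
    lia.
  - by rewrite Z0 mulr0 in E; lia.
split=> //; apply: (@mulfI _ a); first lia.
by rewrite mE in e; lia.
Qed.

Lemma spans_slopesA u v a d c l da q : sg_params a d c l da q ->
  cone_spans u v a d c -> in_cone u v a da ->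
  in_cone u v (a + c * d) (da + c * q) -> slopesA u v a d c l da q.
Proof.
move=> H uvP Pa Pb; have [a2 d0 c1 ca lle lgt det da1 daa q0 qd] := H.
have l0 : 0 <= l by nia.
have cd : 0 <= c * d by rewrite mulr_ge0 //; lia.
have lc : 0 <= l * c by rewrite mulr_ge0 //; lia.
have notin n m x y : n = x * a + y * d -> 0 <= y < a -> x * c < y -> 0 <= n ->
    ~~ in_cone u v n m.
  move=> nE yb yx n0; apply/negP => /(cone_spans_mem uvP n0).
  by rewrite (arith_sg_coordP H nE yb); lia.
have la : 0 <= l * a by rewrite mulr_ge0 //; lia.
have lb : 0 <= l * (a + c * d) by rewrite mulr_ge0 //; lia.
have da0 : 0 <= d * (a - 1) by rewrite mulr_ge0 //; lia.
split.
(* This non-member has coordinates [(l, a - 1)]. The added 1 puts its point on or above the ray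
   through [(b, e)], hence above the cone. *)
- apply: (not_in_cone_above Pb); [|lia|lia|].
    by apply: (notin _ _ l (a - 1)); [ring|lia|lia|lia].
  rewrite -subr_ge0; set X := (X in 0 <= X).
  have -> : X = a + c * d - (a - 1 - l * c) * (d * da - q * a) by rewrite /X; ring.
  by rewrite det; lia.
- by case/andP: Pa.
- by case/andP: Pb.
(* In coordinates [l * b + d] is [(l, l * c + 1)], which exceeds the bound [l * c] by exactly one
   and is still reduced. *)
- apply: (not_in_cone_below Pa); [|lia|lia|].
    by apply: (notin _ _ l (l * c + 1)); [ring|lia|lia|lia].
  rewrite -subr_ge0; set X := (X in 0 <= X).
  have -> : X = (l * c + 1) * (d * da - q * a) by rewrite /X; ring.
  by rewrite det; lia.
Qed.

Lemma spans_slopesC u v a d l da q : sg_params a d (a - 1) l da q ->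
  cone_spans u v a d (a - 1) -> in_cone u v a da ->
  in_cone u v (a + (a - 2) * d) (da + (a - 2) * q) ->
  in_cone u v (a + (a - 1) * d) (da + (a - 1) * q + 1) ->
  q%:~R < d%:~R * u -> slopesC u v a d da q.
Proof.
move=> H uvP Pa Pb Pc qu; have [a2 d0 c1 ca lle lgt det da1 daa q0 qd] := H.
split=> //.
- apply: (not_in_cone_above Pa); [|lia|by rewrite mulr_ge0 //; lia|].
    apply/negP => /(cone_spans_mem uvP)-/(_ ltac:(by rewrite mulr_ge0 //; lia)).
    by rewrite mulrC; apply: (arith_sg_multd H); lia.
  rewrite -subr_ge0; set X := (X in 0 <= X).
  have -> : X = a - (a - 1) * (d * da - q * a) by rewrite /X; ring.
  by rewrite det; lia.
- by case/andP: Pc => _; congr (_%:~R <= _); ring.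
- by case/andP: Pb => + _; congr (_%:~R * _ <= _%:~R); ring.
Qed.

(** Adding [(d, q)] preserves the upper bound and adding [(d, q + 1)] the lower one. The other bound
    comes from any cone point over the next generator, by the side on which it lies. *)
Lemma cone_spans_next u v a d c i m q : 0 <= a + (i + 1) * d ->
  0 <= i + 1 <= c -> cone_spans u v a d c -> q%:~R <= d%:~R * u ->
  d%:~R * u <= d%:~R * v -> d%:~R * v <= (q + 1)%:~R ->
  in_cone u v (a + i * d) m ->
  in_cone u v (a + (i + 1) * d) (m + q) \/ in_cone u v (a + (i + 1) * d) (m + q + 1).
Proof.
move=> n0 ic uvP qu duv qv /andP[Pu Pv].
have /(uvP _ n0)[n /andP[nu nv]] : arith_sg a d c (a + (i + 1) * d).
  exact: arith_sg_gen.
have [nle|nlt] := lerP n (m + q); [left|right].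
  by move: nle; rewrite -(ler_int rat) => ?; apply/andP; split; lra.
have : m + q + 1 <= n by lia.
by rewrite -(ler_int rat) => ?; apply/andP; split; lra.
Qed.

(** If [i < a - 1], a nonnegative combination of the two given points is [a - i] times the point
    [((a - 1) * d, (a - 1) * q + 1)], which would put the non-member [(a - 1) * d] into the
    semigroup. *)
Lemma cone_spans_last u v a d c l da q i : sg_params a d c l da q ->
  cone_spans u v a d c -> in_cone u v a da ->
  in_cone u v (a + i * d) (da + i * q + 1) -> a - 1 <= i.
Proof.
move=> H uvP P0 P; rewrite leNgt; apply/negP => ia.
have [a2 d0 _ _ _ _ det _ _ _ _] := H.
have : arith_sg a d c ((a - 1) * d).
  apply: (cone_spans_mem (m := (a - 1) * q + 1) uvP).
    by rewrite mulr_ge0 //; lia.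
  apply: (in_cone_div (k := a - i)); first by lia.
  have k0 : 0 <= (a - i) * d - 1 - d.
    have : 2 * d <= (a - i) * d by rewrite ler_pM2r //; lia.
    by lia.
  have := in_coneD P (in_coneMl k0 P0).
  have -> : a + i * d + ((a - i) * d - 1 - d) * a = (a - i) * ((a - 1) * d).
    by ring.
  have -> // : da + i * q + 1 + ((a - i) * d - 1 - d) * da =
            (a - i) * ((a - 1) * q + 1).
  transitivity ((a - i - 1) * (d * da) + i * q + 1); first by ring.
  by rewrite det; ring.
by apply: (arith_sg_multd H); lia.
Qed.

Lemma spans_slopesAC u v a d c l da q q' m : sg_params a d c l da q ->
  0 <= u -> v <= 1 -> cone_spans u v a d c ->
  in_cone u v a m -> in_cone u v (a + d) (m + q') ->
  q'%:~R < d%:~R * u -> d%:~R * v < (q' + 1)%:~R ->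
  slopesA u v a d c l da q \/ c = a - 1 /\ slopesC u v a d da q.
Proof.
move=> H u0 v1 uvP P0 P1 q'u q'v; have D1 := spans_det H u0 v1 uvP P0 P1 q'u.
have [a2 d0 c1 ca lle lgt det da1 daa q0 qd] := H.
have uv : u <= v.
  have a0 : 0 < a%:~R :> rat by rewrite ltr0z; lia.
  by case/andP: P0 => mu mv; rewrite -(ler_pM2l a0) (le_trans mu mv).
have d0' : 0 < d%:~R :> rat by rewrite ltr0z.
have duv : d%:~R * u <= d%:~R * v by rewrite ler_pM2l.
have ma : 0 <= m < a.
  apply/andP; split.
    have a0 : 0 <= a%:~R :> rat by rewrite ler0z (le_trans _ a2).
    rewrite -(ler0z rat); case/andP: P0 => mu _; apply: le_trans mu.
    by rewrite mulr_ge0.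
  (* As [u <= 1], the bound on [q'] and the determinant equation put [m] below [a], the range in
     which the solution is unique. *)
  have : q' < d.
    rewrite -(ltr_int rat) (lt_le_trans q'u) //.
    by rewrite ler_piMr ?(le_trans uv) // ltW.
  by clear -D1 a2 d0; nia.
have [mE qE] : m = da /\ q' = q.
  by apply: det_unique d0 D1 _ ma _; clear -det da1 daa; lia.
rewrite {}mE {}qE in P0 P1 q'u q'v.
have next (j : nat) : j%:Z <= c ->
    in_cone u v (a + j%:Z * d) (da + j%:Z * q) \/
    c = a - 1 /\ slopesC u v a d da q.
  elim: j => [|j IHj] jc; first by left; rewrite !mul0r !addr0.
  have jd : 0 <= a + (j%:Z + 1) * d.
    by rewrite addr_ge0 ?mulr_ge0 ?(ltW d0) ?(le_trans _ a2).
  have jc' : 0 <= j%:Z + 1 <= c by rewrite -PoszD addn1.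
  have jc1 : j%:Z <= c by rewrite (le_trans _ jc) // lez_nat.
  have [Pj|] := IHj jc1; last by right.
  rewrite (_ : j.+1%:Z = j%:Z + 1); last by rewrite -addn1 PoszD.
  have qv := ltW q'v; have [|Pj1] := cone_spans_next jd jc' uvP (ltW q'u) duv qv Pj.
    by move=> Pj1; left; move: Pj1; congr (in_cone _ _ _ _); ring.
  have {}Pj1 : in_cone u v (a + (j%:Z + 1) * d) (da + (j%:Z + 1) * q + 1).
    by move: Pj1; congr (in_cone _ _ _ _); ring.
  have ja := cone_spans_last H uvP P0 Pj1.
  (* Leaving the line is possible only at the last index, so [j + 1], [c] and [a - 1] coincide. *)
  have cE : c = a - 1 by apply/le_anti; rewrite ca (le_trans ja).
  have jE : j%:Z = a - 2 by clear -cE ja jc'; lia.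
  rewrite cE in H uvP; rewrite jE (_ : a - 2 + 1 = a - 1) in Pj Pj1; last by ring.
  right; split=> //; exact: (spans_slopesC H uvP P0 Pj Pj1 q'u).
have cE : `|c|%N%:Z = c by clear -c1; lia.
have [||] := next `|c|%N; [by rewrite cE| |by right]; rewrite cE.
by move=> Pc; left; apply: (spans_slopesA H uvP P0 Pc).
Qed.

(** With [q'] the floor of [d * u], the absence of [d] from the semigroup makes both bounds on the
    slopes strict. A cone point over [a + d] then shows that [(d, q')] or [(d, q' + 1)] may be added
    to the point over [a]. *)
Lemma spans_slopes u v a d c l da q : sg_params a d c l da q ->
  0 <= u -> v <= 1 -> cone_spans u v a d c ->
  [\/ slopesA u v a d c l da q, slopesA (1 - v) (1 - u) a d c l da q,
      c = a - 1 /\ slopesC u v a d da q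
    | c = a - 1 /\ slopesC (1 - v) (1 - u) a d da q].
Proof.
move=> H u0 v1 uvP; have [a2 d0 c1 ca lle lgt det da1 daa q0 qd] := H.
have [m P0] : exists m, in_cone u v a m.
  apply/(uvP a ltac:(lia)); have := @arith_sg_gen a d c 0 ltac:(lia).
  by rewrite mul0r addr0.
have [n Pn] : exists n, in_cone u v (a + d) n.
  apply/(uvP (a + d) ltac:(lia)); have := @arith_sg_gen a d c 1 ltac:(lia).
  by rewrite mul1r.
pose q' := Num.floor (d%:~R * u).
have /andP[q'u uq'] : q'%:~R <= d%:~R * u < (q' + 1)%:~R by exact: floor_itv.
have nd m' : ~~ in_cone u v d m'.
  apply/negP => /(cone_spans_mem uvP (ltW d0)).
  by have := arith_sg_multd (s := 1) H; rewrite mul1r; apply; clear -a2; lia.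
have duv : d%:~R * u <= d%:~R * v.
  have a0 : 0 < a%:~R :> rat by rewrite ltr0z (lt_le_trans _ a2).
  have d0' : 0 < d%:~R :> rat by rewrite ltr0z.
  by case/andP: P0 => mu mv; rewrite ler_pM2l // -(ler_pM2l a0) (le_trans mu mv).
have q'u' : q'%:~R < d%:~R * u.
  rewrite lt_neqAle q'u andbT; apply/negP => /eqP q'E.
  by have := nd q'; rewrite /in_cone q'E lexx duv.
have q'v : d%:~R * v < (q' + 1)%:~R.
  by have := nd (q' + 1); rewrite /in_cone (ltW uq') /= -ltNge.
clearbody q'.
have [nle|nlt] := lerP n (m + q').
  have P1 : in_cone u v (a + d) (m + q').
    move: nle P0 Pn; rewrite -(ler_int rat) => nle /andP[P0u P0v] /andP[Pnu Pnv].
    by apply/andP; split; clear -nle P0v Pnu duv q'u; lra.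
  by have [] := spans_slopesAC H u0 v1 uvP P0 P1 q'u' q'v; [constructor 1|constructor 3].
have P1 : in_cone u v (a + d) (m + (q' + 1)).
  have : m + (q' + 1) <= n by clear -nlt; lia.
  rewrite -(ler_int rat) => nlt'; move: P0 Pn => /andP[P0u P0v] /andP[Pnu Pnv].
  by apply/andP; split; clear -P0u Pnv nlt' duv q'v; lra.
(* Reflection sends the step [(d, q' + 1)] to [(d, d - q' - 1)], reducing this case to the previous
   one. *)
have [] := spans_slopesAC (m := a - m) (q' := d - q' - 1) H _ _ (cone_spans_reflect uvP).
- by rewrite subr_ge0.
- by rewrite lerBlDr lerDl.
- by rewrite in_cone_reflect.
- move: P1; rewrite -in_cone_reflect; congr (in_cone _ _ _ _); ring.
- by clear -q'v; lra.
- by clear -q'u'; lra.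
- by constructor 2.
- by constructor 4.
Qed.

(** * Translation of intervals and fractions into cones and slopes *)

Lemma frac_lt (X Y : int) (w : rat) : 0 < X -> 0 <= Y -> 0 < w ->
  (Defs.frac X Y < w%:E)%E = (X%:~R * w^-1 < Y%:~R).
Proof.
move=> X0 Y0 w0; rewrite /Defs.frac; case: eqVneq => [->|Yn].
  (* For [Y = 0] the fraction is infinite, and both sides are false. *)
  by rewrite ltNge leey /= (_ : _ < _ = false) // ltNge mulr_ge0 ?ler0z ?invr_ge0 ?ltW.
have {}Y0 : 0 < Y%:~R :> rat by rewrite ltr0z lt_neqAle eq_sym Yn.
by rewrite lte_fin ltr_pdivrMr // ltr_pdivrMr // mulrC.
Qed.

Lemma frac_ge (X Y : int) (w : rat) : 0 < X -> 0 <= Y -> 0 < w ->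
  (w%:E <= Defs.frac X Y)%E = (Y%:~R <= X%:~R * w^-1).
Proof. by move=> X0 Y0 w0; rewrite leNgt frac_lt // -leNgt. Qed.

Lemma frac_le (X Y : int) (w : rat) : 0 < X -> 0 < Y -> 0 < w ->
  (Defs.frac X Y <= w%:E)%E = (X%:~R * w^-1 <= Y%:~R).
Proof.
move=> X0 Y0 w0; rewrite /Defs.frac gt_eqF //.
by rewrite lee_fin ler_pdivrMr ?ltr0z // ler_pdivrMr // mulrC.
Qed.

Lemma frac_gt (X Y : int) (w : rat) : 0 < X -> 0 <= Y -> 0 < w ->
  (w%:E < Defs.frac X Y)%E = (Y%:~R < X%:~R * w^-1).
Proof.
move=> X0 Y0 w0; rewrite /Defs.frac; case: eqVneq => [->|Yn].
  by rewrite ltry pmulr_lgt0 ?invr_gt0 ?ltr0z.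
have {}Y0 : 0 < Y%:~R :> rat by rewrite ltr0z lt_neqAle eq_sym Yn.
by rewrite lte_fin ltr_pdivlMr // ltr_pdivlMr // mulrC.
Qed.

(** The second coordinate [m] is the number of summands. Conversely, for [m > 0], [n] is the sum of
    [m] copies of [n / m]; for [m = 0] the cone forces [n = 0]. *)
Lemma S_of_intervalP (alpha beta : rat) (n : nat) : 0 < alpha -> 0 < beta ->
  S_of_interval `[alpha, beta] n <->
  exists m, in_cone beta^-1 alpha^-1 n%:Z m.
Proof.
move=> a0 b0; split.
- case=> s [sI sE]; exists (size s)%:Z.
  rewrite /in_cone ler_pdivrMr // ler_pdivlMr // [n%:~R]sE /=.
  elim: s sI {sE} => [|x s IHs] sI; first by rewrite big_nil /= !mul0r lexx.
  have : x \in `[alpha, beta] by apply: sI; rewrite mem_head.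
  rewrite in_itv => /andP[/= xa xb].
  have /andP[sb sa] := IHs (fun y ys => sI y (@mem_behead _ (x :: s) y ys)).
  rewrite big_cons -addn1 PoszD intrD !mulrDl !mul1r.
  by apply/andP; split; lra.
- case=> m; rewrite /in_cone ler_pdivrMr // ler_pdivlMr // => /andP[nb na].
  have m0 : 0 <= m.
    by rewrite -(ler0z rat) -(pmulr_lge0 _ b0); apply: le_trans nb; rewrite ler0n.
  case: m m0 nb na => // m _ nb na; case: m nb na => [|m] nb na.
    exists [::]; split=> //; rewrite big_nil; apply/le_anti.
    by move: nb; rewrite mul0r => ->; rewrite ler0n.
  have m0 : 0 < m.+1%:R :> rat by rewrite ltr0n.
  exists (nseq m.+1 (n%:R / m.+1%:R)); split.
    move=> y /nseqP[-> _] /=; rewrite in_itv /=.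
    by rewrite ler_pdivlMr // ler_pdivrMr // mulrC na mulrC.
  by rewrite big_nseq iter_addr_0 -[RHS]mulr_natr divfK ?gt_eqF.
Qed.

Lemma submonoid_gen_arithP (a d k n : nat) : (1 < k)%N ->
  submonoid_gen [set (a + i * d)%N | i in `I_k] n <->
  arith_sg a%:Z d%:Z (k%:Z - 1) n%:Z.
Proof.
move=> k1; split.
- case=> s [sI ->]; elim: s sI => [|x s IHs] sI.
    by rewrite big_nil; exists 0, 0; split; lia.
  have [/= i ik xE] := sI x (mem_head _ _).
  have [X [Y [sE XY]]] := IHs (fun y ys => sI y (@mem_behead _ (x :: s) y ys)).
  exists (X + 1), (Y + i%:Z); split; last by lia.
  rewrite big_cons PoszD sE -xE; lia.
- case=> [X [Y [nE /andP[Y0 YX]]]].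
  have X0 : 0 <= X by nia.
  case: X X0 YX nE => // X _ YX nE; case: Y Y0 YX nE => // Y _ YX nE.
  have {nE} -> : n = (X * a + Y * d)%N by lia.
  elim: X Y YX => [|X IHX] Y YX.
    by exists [::]; split=> //; rewrite big_nil; nia.
  (* The largest admissible index keeps the rest within the bound for [X] summands. *)
  pose i := minn Y (k - 1).
  have [s [sI sE]] := IHX (Y - i)%N ltac:(rewrite /i; lia).
  exists ((a + i * d)%N :: s); split.
    move=> y; rewrite in_cons => /orP[/eqP ->|]; last exact: sI.
    by exists i => //=; rewrite /i; lia.
  rewrite big_cons -sE.
  have : (i <= Y)%N by rewrite /i; lia.
  nia.
Qed.

Lemma S_of_interval_eqP (a d k : nat) (alpha beta : rat) : (1 < k)%N ->
  0 < alpha -> 0 < beta ->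
  S_of_interval `[alpha, beta] = submonoid_gen [set (a + i * d)%N | i in `I_k] <->
  cone_spans beta^-1 alpha^-1 a%:Z d%:Z (k%:Z - 1).
Proof.
move=> k1 a0 b0; split=> [E n n0|E].
  case: n n0 => // n _.
  by rewrite -submonoid_gen_arithP // -E S_of_intervalP.
apply/seteqP; split=> n.
  by move/(S_of_intervalP _ a0 b0)/(E n%:Z (le0z_nat _))/(submonoid_gen_arithP _ _ _ k1).
by move/(submonoid_gen_arithP _ _ _ k1)/(E n%:Z (le0z_nat _))/(S_of_intervalP _ a0 b0).
Qed.

Lemma sg_params_nat (a d k : nat) (d_a q_a : int) :
  (0 < d)%N -> (2 <= k <= a)%N ->
  d%:Z * d_a = 1 + q_a * a%:Z -> 1 <= d_a < a%:Z -> 0 <= q_a < d%:Z ->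
  sg_params a%:Z d%:Z (k%:Z - 1) ((a - 2) %/ (k - 1))%N d_a q_a.
Proof.
move=> d0 /andP[k2 ka] det /andP[da1 da2] /andP[q0 qd].
have lE := divn_eq (a - 2) (k - 1).
have lr := ltn_pmod (a - 2) (ltac:(lia) : 0 < k - 1)%N.
by split=> //; move: lE lr; set l := (_ %/ _)%N; set r := (_ %% _)%N; clearbody l r; nia.
Qed.

Lemma condA_slopes (a d k l : nat) (d_a q_a : int) (alpha beta : rat) :
  sg_params a%:Z d%:Z (k%:Z - 1) l%:Z d_a q_a -> 0 < alpha -> 0 < beta ->
  condA a d k l d_a q_a alpha beta <->
  slopesA beta^-1 alpha^-1 a%:Z d%:Z (k%:Z - 1) l%:Z d_a q_a.
Proof.
move=> [a2 d0 c1 ca lle lgt det da1 daa q0 qd] a0 b0.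
rewrite /condA /slopesA; move: (k%:Z - 1) c1 ca lle lgt => c c1 ca lle lgt.
move: a%:Z d%:Z l%:Z (le0z_nat l) a2 d0 ca lle lgt det daa qd =>
  {}a {}d {}l l0 a2 d0 ca lle lgt det daa qd.
have cd : 0 <= c * d by rewrite mulr_ge0 //; lia.
have cq : 0 <= c * q_a by rewrite mulr_ge0 //; lia.
have la : 0 <= l * a by rewrite mulr_ge0 //; lia.
have lda : 0 <= l * d_a by rewrite mulr_ge0 //; lia.
have ad : 0 < d * (a - 1) by rewrite mulr_gt0 //; lia.
have aq : 0 <= q_a * (a - 1) by rewrite mulr_ge0 //; lia.
have lb : 0 <= l * (a + c * d) by rewrite mulr_ge0 //; lia.
have le : 0 <= l * (d_a + c * q_a) by rewrite mulr_ge0 //; lia.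
rewrite frac_lt ?frac_ge ?frac_le ?frac_gt //; try lia.
by split=> [[/andP[? ?] /andP[? ?]]|[? ? ? ?]]; do ?split=> //; apply/andP; split.
Qed.

(** Comparing [N * (1 - w)] with [M] amounts to comparing [N * w] with [N - M]: the numerators of
    (A) stay, and each denominator [M] becomes [N - M]. *)
Lemma condB_slopes (a d k l : nat) (d_a q_a : int) (alpha beta : rat) :
  sg_params a%:Z d%:Z (k%:Z - 1) l%:Z d_a q_a -> 0 < alpha -> 0 < beta ->
  condB a d k l d_a q_a alpha beta <->
  slopesA (1 - alpha^-1) (1 - beta^-1) a%:Z d%:Z (k%:Z - 1) l%:Z d_a q_a.
Proof.
move=> [a2 d0 c1 ca lle lgt det da1 daa q0 qd] a0 b0.
rewrite /condB /slopesA; move: (k%:Z - 1) c1 ca lle lgt => c c1 ca lle lgt.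
move: a%:Z d%:Z l%:Z (le0z_nat l) a2 d0 ca lle lgt det daa qd =>
  {}a {}d {}l l0 a2 d0 ca lle lgt det daa qd.
have cdq : 0 <= c * (d - q_a) by rewrite mulr_ge0 //; lia.
have cd : 0 <= c * d by rewrite mulr_ge0 //; lia.
have la : 0 <= l * a by rewrite mulr_ge0 //; lia.
have lda : 0 <= l * (a - d_a) by rewrite mulr_ge0 //; lia.
have ad : 0 < d * (a - 1) by rewrite mulr_gt0 //; lia.
have aq : 0 < (d - q_a) * (a - 1) by rewrite mulr_gt0 //; lia.
have lb : 0 <= l * (a + c * d) by rewrite mulr_ge0 //; lia.
have le : 0 <= l * (a + c * d - (d_a + c * q_a)) by rewrite mulr_ge0 //; lia.
rewrite frac_lt ?frac_ge ?frac_le ?frac_gt //; try lia.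
rewrite !mulrBr !mulr1.
split=> [[/andP[? ?] /andP[? ?]]|[? ? ? ?]]; first by split; lra.
by split; apply/andP; split; lra.
Qed.

Lemma condC_slopes (a d l : nat) (d_a q_a : int) (alpha beta : rat) :
  sg_params a%:Z d%:Z (a%:Z - 1) l%:Z d_a q_a -> 0 < alpha -> 0 < beta ->
  condC a d a d_a q_a alpha beta <->
  slopesC beta^-1 alpha^-1 a%:Z d%:Z d_a q_a.
Proof.
move=> [a2 d0 _ _ _ _ det da1 daa q0 qd] a0 b0.
rewrite /condC /slopesC; move: a%:Z d%:Z a2 d0 det daa qd =>
  {l}a {}d a2 d0 det daa qd.
have ad : 0 < d * (a - 1) by rewrite mulr_gt0 //; lia.
have aq : 0 <= q_a * (a - 1) by rewrite mulr_ge0 //; lia.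
have a2d : 0 <= (a - 2) * d by rewrite mulr_ge0 //; lia.
have a2q : 0 <= (a - 2) * q_a by rewrite mulr_ge0 //; lia.
rewrite frac_lt ?frac_ge ?frac_le ?frac_gt //; try lia.
by split=> [[/andP[? ?] /andP[? ?]]|[? ? ? ?]]; do ?split=> //; apply/andP; split.
Qed.

Lemma condD_slopes (a d l : nat) (d_a q_a : int) (alpha beta : rat) :
  sg_params a%:Z d%:Z (a%:Z - 1) l%:Z d_a q_a -> 0 < alpha -> 0 < beta ->
  condD a d a d_a q_a alpha beta <->
  slopesC (1 - alpha^-1) (1 - beta^-1) a%:Z d%:Z d_a q_a.
Proof.
move=> [a2 d0 _ _ _ _ det da1 daa q0 qd] a0 b0.
rewrite /condD /slopesC; move: a%:Z d%:Z a2 d0 det daa qd =>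
  {l}a {}d a2 d0 det daa qd.
have ad : 0 < d * (a - 1) by rewrite mulr_gt0 //; lia.
have aq : 0 < (d - q_a) * (a - 1) by rewrite mulr_gt0 //; lia.
have a2d : 0 <= (a - 2) * d by rewrite mulr_ge0 //; lia.
have a2q : 0 <= (a - 2) * (d - q_a) by rewrite mulr_ge0 //; lia.
rewrite frac_lt ?frac_ge ?frac_le ?frac_gt //; try lia.
rewrite !mulrBr !mulr1.
split=> [[/andP[? ?] /andP[? ?]]|[? ? ? ?]]; first by split; lra.
by split; apply/andP; split; lra.
Qed.

Theorem theorem12 (a d k : nat) (d_a q_a : int) (alpha beta : rat)
    (a_gt0 : (0 < a)%N) (d_gt0 : (0 < d)%N) (k_gt0 : (0 < k)%N)
    (co_ad : coprime a d) (k_bounds : (2 <= k <= a)%N)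
    (d_aE : d%:Z * d_a = 1 + q_a * a%:Z)
    (d_a_bounds : 1 <= d_a < a%:Z) (q_a_bounds : 0 <= q_a < d%:Z)
    (alpha_ge1 : 1 <= alpha) (beta_ge1 : 1 <= beta) :
  let lam := ((a - 2) %/ (k - 1))%N in
  let S := submonoid_gen [set (a + i * d)%N | i in `I_k] in
  let A := condA a d k lam d_a q_a alpha beta in
  let B := condB a d k lam d_a q_a alpha beta in
  let C := condC a d k d_a q_a alpha beta in
  let D := condD a d k d_a q_a alpha beta in
  ((k < a)%N -> (S_of_interval `[alpha, beta] = S <-> A \/ B)) /\
  (k = a -> (S_of_interval `[alpha, beta] = S <-> A \/ B \/ C \/ D)).
Proof.
move=> lam S A B C D.
have H := sg_params_nat d_gt0 k_bounds d_aE d_a_bounds q_a_bounds.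
have k2 : (1 < k)%N by case/andP: k_bounds.
have a0 : 0 < alpha by apply: lt_le_trans alpha_ge1.
have b0 : 0 < beta by apply: lt_le_trans beta_ge1.
have u0 : 0 <= beta^-1 by rewrite invr_ge0 ltW.
have v1 : alpha^-1 <= 1 by rewrite invf_le1.
have AP : A <-> _ := condA_slopes H a0 b0.
have BP : B <-> _ := condB_slopes H a0 b0.
have SP := S_of_interval_eqP a d k2 a0 b0.
have nec := spans_slopes H u0 v1.
(* Reflecting twice restores the cone, so (B) and (D) suffice by the arguments for (A) and (C). *)
have reflect c : cone_spans (1 - alpha^-1) (1 - beta^-1) a%:Z d%:Z c ->
    cone_spans beta^-1 alpha^-1 a%:Z d%:Z c.
  by move/cone_spans_reflect; rewrite !subKr.
have sufA : A -> S_of_interval `[alpha, beta] = S.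
  by move/AP/(slopesA_spans H)/SP.
have sufB : B -> S_of_interval `[alpha, beta] = S.
  by move/BP/(slopesA_spans H)/reflect/SP.
split=> [ka|ka].
  (* The last two outcomes would require [k - 1 = a - 1], impossible for [k < a]. *)
  split=> [/SP/nec[/AP|/BP|[]|[]]|[]//]; [by left|by right|lia|lia].
subst k; rewrite /C /D.
have CP := condC_slopes H a0 b0.
have DP := condD_slopes H a0 b0.
split.
  case/SP/nec=> [/AP|/BP|[_ /CP]|[_ /DP]] ?;
    [by left|by right; left|by do 2!right; left|by do 3!right].
case=> [//|[//|[|]]]; first by move/CP/(slopesC_spans H)/SP.
by move/DP/(slopesC_spans H)/reflect/SP.
Qed.
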